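(* Assume that $(A_N)_{N\ge1}$, $(A_N^T)_{N\ge1}$ and $(C_N)_{N\ge1}$ converge (jointly, infinitesimally) in distribution with respect to $\Psi_N$ to random variables $a$, $\bar a$ and $c$, respectively. Then: - $a$ and $\bar a$ are not infinitesimally Boolean independent; - $a$ and $c$ are not infinitesimally Boolean independent.
   Context: $X_1,X_2,\dots$ are independent identically distributed centered complex Gaussian random variables with $\mathbb{E}(X_i^p\overline{X_i}^q)=p!$ if $p=q$ and $0$ otherwise. $A_N=\big(\frac1N(X_i+\overline{X_j})\big)_{i,j=1}^N$ is an $N\times N$ random matrix, $A_N^T$ its transpose, and $C_N$ is the $N\times N$ matrix all of whose entries equal $\frac1N$. For a random $N\times N$ matrix $M=(M_{ij})$, $\Psi_N(M)=\mathbb{E}(\mathrm{Tr}(MC_N))=\frac1N\sum_{i,j=1}^N\mathbb{E}(M_{ij})$. The limit variables are described by functionals on non-commutative polynomials: for every non-commutative polynomial $p$, $\varphi(p(a,\bar a,c))=\lim_{N\to\infty}\Psi_N(p(A_N,A_N^T,C_N))$ and $\varphi'(p(a,\bar a,c))=\lim_{N\to\infty}N\big(\Psi_N(p(A_N,A_N^T,C_N))-\varphi(p(a,\bar a,c))\big)$. Elements $u,v$ are infinitesimally Boolean independent with respect to $(\varphi,\varphi')$ if, with $\mathcal{A}_1$, $\mathcal{A}_2$ the non-unital algebras generated by $u$ and $v$ respectively, for all $n\in\mathbb{N}$, $i_1\neq i_2\ne\cdots\ne i_n$ in $\{1,2\}$ (consecutive indices distinct) and $x_j\in\mathcal{A}_{i_j}$: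 $\varphi(x_1\cdots x_n)=\varphi(x_1)\cdots\varphi(x_n)$ and $\varphi'(x_1\cdots x_n)=\sum_{j=1}^n\varphi(x_1)\cdots\varphi(x_{j-1})\varphi'(x_j)\varphi(x_{j+1})\cdots\varphi(x_n)$. *)

(* Defs.v *)
From HB Require Import structures.
From mathcomp Require Import all_boot all_order all_algebra.
From mathcomp Require Import complex.
From mathcomp Require Import all_classical all_reals all_analysis.
(* The notations of monalg clash with those of MathComp-Analysis. *)
From mathcomp.multinomials Require Import -(notations) monalg.

Set Implicit Arguments.
Unset Strict Implicit.
Unset Printing Implicit Defensive.

Import Order.TTheory GRing.Theory Num.Theory.
Import numFieldNormedType.Exports.

Local Open Scope classical_set_scope.
Local Open Scope ring_scope.

Section ComplexRandomVariables.
Context (R : realType) (d : measure_display) (T : measurableType d).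
Variable P : probability T R.
Implicit Types (Z : T -> R[i]) (X : nat -> T -> R[i]).

Definition reim (z : R[i]) : measurableTypeR R * measurableTypeR R :=
  (complex.Re z, complex.Im z).

(* Measurability for the Borel sigma-algebra of C = R^2. *)
Definition cmeasurable Z : Prop :=
  measurable_fun setT (fun w => complex.Re (Z w)) /\
  measurable_fun setT (fun w => complex.Im (Z w)).

Definition cintegrable Z : Prop :=
  P.-integrable setT (EFin \o (fun w => complex.Re (Z w))) /\
  P.-integrable setT (EFin \o (fun w => complex.Im (Z w))).

(* Meaningful only for cintegrable Z, since fine maps the infinities to 0. *)
Definition cexpectation Z : R[i] :=
  Complex (fine 'E_P[fun w => complex.Re (Z w)])
          (fine 'E_P[fun w => complex.Im (Z w)]).

(* The library's normal_prob m 0 is a uniform law, hence the case split. *)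
Definition gaussian_law (m s : R) (B : set (measurableTypeR R)) : \bar R :=
  if s == 0 then dirac m B else normal_prob m s B.

(* (Re Z, Im Z) is a centered, possibly degenerate, Gaussian vector. *)
Definition centered_cgaussian Z : Prop :=
  cmeasurable Z /\
  forall s t : R, exists sigma : R, forall B : set (measurableTypeR R),
    measurable B ->
    P [set w | B (s * complex.Re (Z w) + t * complex.Im (Z w))]
    = gaussian_law 0 sigma B.

Definition identically_distributed X : Prop :=
  forall i j (B : set (measurableTypeR R * measurableTypeR R)), measurable B ->
    P [set w | B (reim (X i w))] = P [set w | B (reim (X j w))].

Definition mutually_independent X : Prop :=
  forall (J : seq nat)
    (B : nat -> set (measurableTypeR R * measurableTypeR R)),
    uniq J -> (forall i, measurable (B i)) ->
    P (\bigcap_(i in [set` J]) [set w | B i (reim (X i w))])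
    = (\prod_(i <- J) P [set w | B i (reim (X i w))])%E.

Definition standard_moments Z : Prop :=
  forall p q : nat,
    let Zpq := fun w => Z w ^+ p * (Num.conj (Z w)) ^+ q in
    cintegrable Zpq /\ cexpectation Zpq = if p == q then p`!%:R else 0.

Definition iid_standard_cgaussian X : Prop :=
  [/\ forall i, centered_cgaussian (X i),
      forall i, standard_moments (X i),
      identically_distributed X &
      mutually_independent X].

(* The variables X_1, X_2, ... of the mathematical text are X 0, X 1, ... *)
Definition A_mx X (N : nat) (w : T) : 'M[R[i]]_N :=
  \matrix_(i < N, j < N) (N%:R^-1 * (X i w + Num.conj (X j w))).

Definition C_mx (N : nat) : 'M[R[i]]_N := const_mx N%:R^-1.

Definition Psi (N : nat) (M : T -> 'M[R[i]]_N) : R[i] :=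
  cexpectation (fun w => \tr (M w *m C_mx N)).

End ComplexRandomVariables.

Section NonCommutativePolynomials.
Context (K : comNzRingType).

(* The algebra of the free monoid on three letters. *)
Definition ncpoly := malg (fmonom 'I_3) K.

Definition nceval (A : algType K) (x y z : A) (p : ncpoly) : A :=
  mmap (in_alg A)
    (fun m : fmonom 'I_3 =>
       \prod_(i <- fmonom_val m) tnth [tuple x; y; z] i) p.

End NonCommutativePolynomials.

Section InfinitesimalBooleanIndependence.
Context (K : comNzRingType) (A : algType K).

Definition nonunital_subalgebra (S : set A) : Prop :=
  [/\ S 0,
      forall x y, S x -> S y -> S (x + y),
      forall (k : K) x, S x -> S (k *: x) &
      forall x y, S x -> S y -> S (x * y)].

Definition nonunital_generated (u : A) : set A :=
  smallest nonunital_subalgebra [set u].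

(* The index i j, a boolean, tells which of the two algebras contains x j. *)
Definition inf_boolean_independent (phi phi' : A -> K) (u v : A) : Prop :=
  forall (n : nat) (i : nat -> bool) (x : nat -> A),
    (0 < n)%N ->
    (forall j, (j.+1 < n)%N -> i j != i j.+1) ->
    (forall j, (j < n)%N -> nonunital_generated (if i j then v else u) (x j)) ->
    phi (\prod_(0 <= j < n) x j) = \prod_(0 <= j < n) phi (x j) /\
    phi' (\prod_(0 <= j < n) x j) =
      \sum_(0 <= j < n) (\prod_(0 <= k < j) phi (x k)) * phi' (x j) *
                        (\prod_(j.+1 <= k < n) phi (x k)).

End InfinitesimalBooleanIndependence.

Section InfinitesimalConvergence.
Context (R : realType) (d : measure_display) (T : measurableType d).
Variable P : probability T R.

(* Matrices of size N >= 1 are indexed by N.-1, so that they form a unital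
   algebra in which polynomials can be evaluated. *)
Definition cvg_inf_distribution (U V W : forall N, T -> 'M[R[i]]_N)
    (A : algType R[i]) (phi phi' : A -> R[i]) (a b c : A) : Prop :=
  forall p : ncpoly R[i],
    let psi := fun n : nat =>
      Psi P (fun w => nceval (U n.+1 w) (V n.+1 w) (W n.+1 w) p) in
    let l := phi (nceval a b c p) in
    (psi n @[n --> \oo] --> (l : R[i]^o)) /\
    (n.+1%:R * (psi n - l) @[n --> \oo] -->
       (phi' (nceval a b c p) : R[i]^o)).

End InfinitesimalConvergence.

(* Main.v *)
(* With Y_ij = X_i + conj X_j one has E Y_ij = 0 and
   E (Y_ij Y_kl) = [i = l] + [k = j], whence Psi_N (A_N) = Psi_N (A_N^T) = 0 and
   Psi_N (A_N A_N^T) = Psi_N (A_N C_N A_N) = 2 / N for every N.  So phi vanishes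
   at a and abar, and Boolean independence would make both phi and phi' vanish
   at the word a abar (resp. a c a), although N (2 / N - 0) = 2. *)
Require Import Defs.
From mathcomp Require Import all_boot all_order all_algebra.
From mathcomp Require Import complex.
From mathcomp Require Import all_classical all_reals all_analysis.
From mathcomp Require Import measurable_realfun.
From mathcomp.multinomials Require Import -(notations) monalg.
From mathcomp Require Import ring.

Import Order.TTheory GRing.Theory Num.Theory.
Import numFieldNormedType.Exports.

Local Open Scope classical_set_scope.
Local Open Scope ring_scope.

(** * Products of functions of two independent random variables *)

Section Independence.
Local Open Scope ereal_scope.
Context {R : realType} {d d1 d2 : measure_display} {T : measurableType d}
  {T1 : measurableType d1} {T2 : measurableType d2}.
Variable P : probability T R.
Variables (U : {mfun T >-> T1}) (V : {mfun T >-> T2}).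
Hypothesis UV : forall A B, measurable A -> measurable B ->
  P (U @^-1` A `&` V @^-1` B) = P (U @^-1` A) * P (V @^-1` B).
Variables (f : T1 -> R) (g : T2 -> R).
Hypotheses (mf : measurable_fun setT f) (mg : measurable_fun setT g).
Hypotheses (iU : P.-integrable setT (EFin \o (f \o U)))
           (iV : P.-integrable setT (EFin \o (g \o V))).

Let pU := distribution P U.
Let pV := distribution P V.
Let UxV w := (U w, V w).
Let mUxV : measurable_fun setT UxV.
Proof. exact: measurable_fun_pair. Qed.
Let pUV := distribution P (mfun_Sub (mem_set mUxV)).
Let h (z : T1 * T2) : \bar R := (f z.1 * g z.2)%:E.

(** A product measure is determined by its values on measurable rectangles, and on these [UV] says
    exactly that the joint law factorizes. *)
Let pUVE B : measurable B -> (pU \x pV) B = pUV B.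
Proof. by apply: product_measure_unique => A C mA mC; rewrite -UV. Qed.

Let mh : measurable_fun [set: T1 * T2] h.
Proof.
apply/measurable_EFinP; apply: measurable_funM.
  exact: (measurableT_comp mf measurable_fst).
exact: (measurableT_comp mg measurable_snd).
Qed.

Let mEf : measurable_fun setT (EFin \o f).
Proof. exact/measurable_EFinP. Qed.
Let mEg : measurable_fun setT (EFin \o g).
Proof. exact/measurable_EFinP. Qed.

Let ipU : pU.-integrable setT (EFin \o f).
Proof. by apply: integrable_pushforward. Qed.
Let ipV : pV.-integrable setT (EFin \o g).
Proof. by apply: integrable_pushforward. Qed.

(** Tonelli: for fixed $x$ the integral of $|f(x)g(y)|$ in $y$ is $|f(x)|$ times the $L^1$ norm of
    $g$, and this is integrable in $x$ because $f$ is. *)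
Let ih : (pU \x pV).-integrable setT h.
Proof.
apply/integrable12ltyP => //.
(* Finiteness lets the inner integral be written as a real constant through [fine], and so be pulled
   out of the outer integral. *)
have nV : \int[pV]_y `|(g y)%:E| \is a fin_num.
  rewrite ge0_fin_numE ?integral_ge0//.
  by have /integrableP[] := ipV.
have hE x : \int[pV]_y `|h (x, y)| =
            `|(f x)%:E| * (fine (\int[pV]_y `|(g y)%:E|))%:E.
  rewrite fineK// -ge0_integralZl//; last exact: measurableT_comp.
  by apply: eq_integral => y _; rewrite /h EFinM abseM.
under eq_integral do rewrite hE.
rewrite ge0_integralZr//; last 2 first.
  exact: measurableT_comp.
  by rewrite lee_fin fine_ge0// integral_ge0.
apply: lte_mul_pinfty => //; first exact: integral_ge0.
  rewrite ge0_fin_numE ?integral_ge0//.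
  by have /integrableP[] := ipU.
by rewrite ltry.
Qed.

Lemma integrable_indepM :
  P.-integrable setT (EFin \o (fun w => f (U w) * g (V w))%R).
Proof.
apply/integrableP; split.
  by apply/measurable_EFinP; apply: measurable_funM; exact: measurableT_comp.
have /integrableP[_] := ih.
rewrite (eq_measure_integral pUV) => [|A mA _]; last exact: pUVE.
by rewrite ge0_integral_distribution //; exact: measurableT_comp.
Qed.

(** Both sides are moved to the laws of [U] and [V]; there the joint law is the product measure, and
    Fubini separates the two factors. *)
Lemma integral_indepM :
  \int[P]_w (f (U w) * g (V w))%:E =
  \int[P]_w (f (U w))%:E * \int[P]_w (g (V w))%:E.
Proof.
have -> : \int[P]_w (f (U w) * g (V w))%:E = \int[pU \x pV]_z h z.
  rewrite (eq_measure_integral pUV) => [|A mA _]; last exact: pUVE.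
  by rewrite integral_distribution //; exact: integrable_indepM.
rewrite -integral12_prod_meas1//.
have nV : \int[pV]_y (g y)%:E \is a fin_num by exact: integrable_fin_num.
have hE x : \int[pV]_y h (x, y) = (f x)%:E * (fine (\int[pV]_y (g y)%:E))%:E.
  by rewrite fineK// -integralZl.
under eq_integral do rewrite /fubini_F hE.
rewrite integralZr// fineK//.
by rewrite !integral_distribution.
Qed.

End Independence.

(** * Complex expectation: linearity, and multiplicativity under independence *)

Section ComplexExpectation.
Context {R : realType} {d : measure_display} {T : measurableType d}.
Variable P : probability T R.
Implicit Types Z W : T -> R[i].

Let mT : measurable [set: T] := measurableT.

(** Exposes the real-valued integrals, so that their linearity can be used on each component. *)
Lemma cexpectationE Z : cexpectation P Z =
  Complex (\int[P]_w complex.Re (Z w)) (\int[P]_w complex.Im (Z w)).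
Proof. by rewrite /cexpectation unlock. Qed.

Lemma ReD (x y : R[i]) : complex.Re (x + y) = complex.Re x + complex.Re y.
Proof. by case: x y => [? ?] []. Qed.

Lemma ImD (x y : R[i]) : complex.Im (x + y) = complex.Im x + complex.Im y.
Proof. by case: x y => [? ?] []. Qed.

Lemma ReM (x y : R[i]) : complex.Re (x * y) =
  complex.Re x * complex.Re y - complex.Im x * complex.Im y.
Proof. by case: x y => [? ?] []. Qed.

Lemma ImM (x y : R[i]) : complex.Im (x * y) =
  complex.Re x * complex.Im y + complex.Im x * complex.Re y.
Proof. by case: x y => [? ?] []. Qed.

Lemma Re_conj (x : R[i]) : complex.Re (Num.conj x) = complex.Re x.
Proof. by case: x. Qed.

Lemma Im_conj (x : R[i]) : complex.Im (Num.conj x) = - complex.Im x.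
Proof. by case: x. Qed.

Lemma eq_integrable_EFin (f g : T -> R) : f =1 g ->
  P.-integrable setT (EFin \o f) -> P.-integrable setT (EFin \o g).
Proof. by move=> /funext ->. Qed.

Lemma integrable_EFinD (f g : T -> R) :
  P.-integrable setT (EFin \o f) -> P.-integrable setT (EFin \o g) ->
  P.-integrable setT (EFin \o (fun w => f w + g w)).
Proof. by move=> fi gi; exact: (integrableD mT fi gi). Qed.

Lemma integrable_EFinB (f g : T -> R) :
  P.-integrable setT (EFin \o f) -> P.-integrable setT (EFin \o g) ->
  P.-integrable setT (EFin \o (fun w => f w - g w)).
Proof. by move=> fi gi; exact: (integrableB mT fi gi). Qed.

Lemma integrable_EFinZ k (f : T -> R) :
  P.-integrable setT (EFin \o f) ->
  P.-integrable setT (EFin \o (fun w => k * f w)).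
Proof. by move=> fi; exact: (integrableZl mT k fi). Qed.

Lemma cintegrable0 : cintegrable P (fun=> 0).
Proof. by split; exact: integrable0. Qed.

Lemma cintegrableD Z W : cintegrable P Z -> cintegrable P W ->
  cintegrable P (fun w => Z w + W w).
Proof.
move=> [Zr Zi] [Wr Wi]; split.
  apply: eq_integrable_EFin (integrable_EFinD _ _ Zr Wr) => w.
  by rewrite ReD.
apply: eq_integrable_EFin (integrable_EFinD _ _ Zi Wi) => w.
by rewrite ImD.
Qed.

Lemma cexpectationD Z W : cintegrable P Z -> cintegrable P W ->
  cexpectation P (fun w => Z w + W w) = cexpectation P Z + cexpectation P W.
Proof.
move=> [Zr Zi] [Wr Wi]; rewrite !cexpectationE.
under eq_Rintegral do rewrite ReD.
under [X in Complex _ X]eq_Rintegral do rewrite ImD.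
by rewrite !RintegralD.
Qed.

Lemma cintegrableZ k Z : cintegrable P Z -> cintegrable P (fun w => k * Z w).
Proof.
move=> [Zr Zi]; split.
  apply: (@eq_integrable_EFin
    (fun w => complex.Re k * complex.Re (Z w) - complex.Im k * complex.Im (Z w))).
    by move=> w; rewrite ReM.
  by apply: integrable_EFinB; exact: integrable_EFinZ.
apply: (@eq_integrable_EFin
  (fun w => complex.Re k * complex.Im (Z w) + complex.Im k * complex.Re (Z w))).
  by move=> w; rewrite ImM.
by apply: integrable_EFinD; exact: integrable_EFinZ.
Qed.

Lemma cexpectationZ k Z : cintegrable P Z ->
  cexpectation P (fun w => k * Z w) = k * cexpectation P Z.
Proof.
move=> [Zr Zi]; rewrite !cexpectationE.
under eq_Rintegral do rewrite ReM.
under [X in Complex _ X]eq_Rintegral do rewrite ImM.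
rewrite RintegralB ?RintegralD ?RintegralZl//; try exact: integrable_EFinZ.
by case: k.
Qed.

Lemma cintegrable_sum I (s : seq I) (Z : I -> T -> R[i]) :
  (forall i, cintegrable P (Z i)) ->
  cintegrable P (fun w => \sum_(i <- s) Z i w).
Proof.
move=> Zi; elim: s => [|i s ih].
  rewrite (_ : (fun _ => _) = fun=> 0); first exact: cintegrable0.
  by apply/funext => w; rewrite big_nil.
rewrite (_ : (fun _ => _) = fun w => Z i w + \sum_(j <- s) Z j w).
  exact: cintegrableD.
by apply/funext => w; rewrite big_cons.
Qed.

Lemma cexpectation_sum I (s : seq I) (Z : I -> T -> R[i]) :
  (forall i, cintegrable P (Z i)) ->
  cexpectation P (fun w => \sum_(i <- s) Z i w) =
  \sum_(i <- s) cexpectation P (Z i).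
Proof.
move=> Zi; elim: s => [|i s ih].
  rewrite big_nil (_ : (fun _ => _) = fun=> 0); last first.
    by apply/funext => w; rewrite big_nil.
  by rewrite cexpectationE/= Rintegral_cst// mul0r.
rewrite big_cons (_ : (fun _ => _) = fun w => Z i w + \sum_(j <- s) Z j w).
  by rewrite cexpectationD ?ih//; exact: cintegrable_sum.
by apply/funext => w; rewrite big_cons.
Qed.

(** The two-variable case of [mutually_independent]. Using Borel sets of the plane, rather than of
    each coordinate, makes it stable under measurable maps such as conjugation. *)
Definition cindep Z W := forall A B, measurable A -> measurable B ->
  P ([set w | A (reim (Z w))] `&` [set w | B (reim (W w))]) =
  (P [set w | A (reim (Z w))] * P [set w | B (reim (W w))])%E.

Lemma measurable_reim Z :
  cmeasurable Z -> measurable_fun setT (reim (R:=R) \o Z).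
Proof. by move=> [mr mi]; exact: measurable_fun_pair. Qed.

Lemma cmeasurable_conj Z :
  cmeasurable Z -> cmeasurable (fun w => Num.conj (Z w)).
Proof.
move=> [mr mi]; split.
  by rewrite (_ : (fun _ => _) = fun w => complex.Re (Z w))//;
    apply/funext => w; rewrite Re_conj.
rewrite (_ : (fun _ => _) = fun w => - complex.Im (Z w)).
  exact: measurableT_comp.
by apply/funext => w; rewrite Im_conj.
Qed.

(** Conjugation is the measurable reflection $c(x,y)=(x,-y)$ of the plane, so an event on the
    conjugate of [W] with set [B] is the event on [W] with the preimage of [B] under $c$. *)
Lemma cindep_conjr Z W : cindep Z W -> cindep Z (fun w => Num.conj (W w)).
Proof.
move=> ZW A B mA mB.
pose c (z : measurableTypeR R * measurableTypeR R) := (z.1, - z.2).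
have mc : measurable_fun setT c.
  by apply: measurable_fun_pair => //; exact: measurableT_comp.
have cE w : reim (Num.conj (W w)) = c (reim (W w)) by case: (W w).
under [X in _ `&` X]eq_set do rewrite cE.
under [X in (_ * P X)%E]eq_set do rewrite cE.
by apply: (ZW A (c @^-1` B)) => //; rewrite -[_ @^-1` _]setTI; exact: mc.
Qed.

Lemma cindepC Z W : cindep Z W -> cindep W Z.
Proof. by move=> ZW A B mA mB; rewrite setIC ZW// muleC. Qed.

(** Meant for [f] and [g] among the two coordinate projections, which yields every real product
    occurring in the expansion of $ZW$. *)
Lemma integrable_cindepM (f g : measurableTypeR R * measurableTypeR R -> R) Z W :
  measurable_fun setT f -> measurable_fun setT g ->
  cmeasurable Z -> cmeasurable W -> cindep Z W ->
  P.-integrable setT (EFin \o (fun w => f (reim (Z w)))) ->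
  P.-integrable setT (EFin \o (fun w => g (reim (W w)))) ->
  P.-integrable setT (EFin \o (fun w => f (reim (Z w)) * g (reim (W w)))) /\
  \int[P]_w (f (reim (Z w)) * g (reim (W w))) =
  \int[P]_w f (reim (Z w)) * \int[P]_w g (reim (W w)).
Proof.
move=> mf mg /measurable_reim mZ /measurable_reim mW ZW fi gi.
(* Once both variables are packaged as measurable maps to the plane, [ZW] is literally the
   factorization hypothesis of the previous section. *)
pose U : {mfun T >-> (measurableTypeR R * measurableTypeR R)%type} :=
  mfun_Sub (mem_set mZ).
pose V : {mfun T >-> (measurableTypeR R * measurableTypeR R)%type} :=
  mfun_Sub (mem_set mW).
split; first exact: (@integrable_indepM _ _ _ _ _ _ _ P U V ZW f g mf mg fi gi).
rewrite /Rintegral (@integral_indepM _ _ _ _ _ _ _ P U V ZW f g mf mg fi gi)//.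
by rewrite fineM//; exact: integrable_fin_num.
Qed.

(** The real and imaginary parts of $ZW$ are combinations of four real products, each of which
    factorizes by independence; the results reassemble into a complex product. *)
Lemma cindepM Z W :
  cmeasurable Z -> cmeasurable W -> cintegrable P Z -> cintegrable P W ->
  cindep Z W ->
  cintegrable P (fun w => Z w * W w) /\
  cexpectation P (fun w => Z w * W w) = cexpectation P Z * cexpectation P W.
Proof.
move=> mZ mW [Zr Zi] [Wr Wi] ZW.
have mfst : measurable_fun setT
    (fun z : measurableTypeR R * measurableTypeR R => z.1 : R).
  exact: measurable_fst.
have msnd : measurable_fun setT
    (fun z : measurableTypeR R * measurableTypeR R => z.2 : R).
  exact: measurable_snd.
have [irr Err] := @integrable_cindepM _ _ _ _ mfst mfst mZ mW ZW Zr Wr.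
have [iri Eri] := @integrable_cindepM _ _ _ _ mfst msnd mZ mW ZW Zr Wi.
have [iir Eir] := @integrable_cindepM _ _ _ _ msnd mfst mZ mW ZW Zi Wr.
have [iii Eii] := @integrable_cindepM _ _ _ _ msnd msnd mZ mW ZW Zi Wi.
split.
  split.
    apply: eq_integrable_EFin (integrable_EFinB _ _ irr iii) => w.
    by rewrite ReM.
  apply: eq_integrable_EFin (integrable_EFinD _ _ iri iir) => w.
  by rewrite ImM.
rewrite !cexpectationE.
under eq_Rintegral do rewrite ReM.
under [X in Complex _ X]eq_Rintegral do rewrite ImM.
rewrite RintegralB// RintegralD//.
by congr Complex; [congr (_ - _)|congr (_ + _)].
Qed.

End ComplexExpectation.

(** * First and second moments of the matrix entries *)

Section StandardCGaussian.
Context {R : realType} {d : measure_display} {T : measurableType d}.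
Variables (P : probability T R) (X : nat -> T -> R[i]).
Hypothesis hX : iid_standard_cgaussian P X.

(** This is $N$ times an entry of $A_N$; it does not depend on $N$, so all powers of $1/N$ can be
    collected as scalars. *)
Let Y i j w := X i w + Num.conj (X j w).

Let mX i : cmeasurable (X i).
Proof. by case: hX => /(_ i) []. Qed.

(** Working up to pointwise equality absorbs the trivial factor that appears when $p$ or $q$ is
    zero. *)
Let moment i p q Z : Z =1 (fun w => X i w ^+ p * Num.conj (X i w) ^+ q) ->
  cintegrable P Z /\ cexpectation P Z = if p == q then p`!%:R else 0.
Proof. by case: hX => _ /(_ i p q) /= ? _ _ /funext ->. Qed.

Let EX i : cintegrable P (X i) /\ cexpectation P (X i) = 0.
Proof. by apply: (@moment i 1 0) => w; rewrite mulr1. Qed.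

Let EXc i : cintegrable P (fun w => Num.conj (X i w)) /\
  cexpectation P (fun w => Num.conj (X i w)) = 0.
Proof. by apply: (@moment i 0 1) => w; rewrite mul1r. Qed.

Let indepX i j : i != j -> cindep P (X i) (X j).
Proof.
move=> ij A B mA mB; case: hX => _ _ _ indep.
(* The family of sets must be indexed by all naturals; only its values at [i] and [j] matter for the
   list [[:: i; j]]. *)
pose F k := if k == i then A else B.
have := indep [:: i; j] F.
rewrite !big_cons big_nil mule1 /F eqxx eq_sym (negbTE ij) /= inE ij => <-//.
  congr (P _); apply/seteqP; split=> [w [Aw Bw] k /=|w AB].
    by rewrite !inE => /orP[]/eqP->; rewrite ?eqxx// eq_sym (negbTE ij).
  split; first by have := AB i; rewrite /= eqxx; apply; rewrite !inE eqxx.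
  by have := AB j; rewrite /= eq_sym (negbTE ij); apply; rewrite !inE eqxx orbT.
by move=> k; case: ifP.
Qed.

Let EXX i j : cintegrable P (fun w => X i w * X j w) /\
  cexpectation P (fun w => X i w * X j w) = 0.
Proof.
have [<-|ij] := eqVneq i j; first by apply: (@moment i 2 0) => w; rewrite mulr1.
have [|? ->] := cindepM P _ _ (mX i) (mX j) (EX i).1 (EX j).1.
  exact: indepX.
by rewrite (EX i).2 mul0r.
Qed.

(** The one second moment that can be nonzero: on the diagonal it is $1!=1$, and off the diagonal
    independence gives a product of zero means. *)
Let EXXc i j : cintegrable P (fun w => X i w * Num.conj (X j w)) /\
  cexpectation P (fun w => X i w * Num.conj (X j w)) = (i == j)%:R.
Proof.
have [<-|ij] := eqVneq i j; first exact: (@moment i 1 1).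
have [|? ->] := cindepM P _ _ (mX i) (cmeasurable_conj _ (mX j))
  (EX i).1 (EXc j).1.
  exact/cindep_conjr/indepX.
by rewrite (EX i).2 mul0r.
Qed.

Let EXcXc i j : cintegrable P (fun w => Num.conj (X i w) * Num.conj (X j w)) /\
  cexpectation P (fun w => Num.conj (X i w) * Num.conj (X j w)) = 0.
Proof.
have [<-|ij] := eqVneq i j; first by apply: (@moment i 0 2) => w; rewrite mul1r.
have [|? ->] := cindepM P _ _ (cmeasurable_conj _ (mX i))
  (cmeasurable_conj _ (mX j)) (EXc i).1 (EXc j).1.
  (* Conjugation is only available on the right, so the two variables are swapped in order to
     conjugate both; this also reverses the inequality of indices. *)
  exact/cindep_conjr/cindepC/cindep_conjr/indepX/(contra_neq esym).
by rewrite (EXc i).2 mul0r.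
Qed.

Lemma expectation_entry i j :
  cintegrable P (Y i j) /\ cexpectation P (Y i j) = 0.
Proof.
have [iXi EXi] := EX i; have [iXj EXj] := EXc j.
by split; [exact: cintegrableD|rewrite cexpectationD// EXi EXj addr0].
Qed.

Lemma covariance_entry i j k l : cintegrable P (fun w => Y i j w * Y k l w) /\
  cexpectation P (fun w => Y i j w * Y k l w) = (i == l)%:R + (k == j)%:R.
Proof.
have [i1 e1] := EXX i k; have [i2 e2] := EXXc i l.
have [i3 e3] := EXXc k j; have [i4 e4] := EXcXc j l.
(* The four products are arranged so that the two mixed ones, the only ones to contribute, have
   their conjugated factor on the right, as in [EXXc]. *)
rewrite (_ : (fun w => _) = fun w => (X i w * X k w + X i w * Num.conj (X l w)) +
  (X k w * Num.conj (X j w) + Num.conj (X j w) * Num.conj (X l w))); last first.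
  by apply/funext => w; rewrite /Y; ring.
have i12 := cintegrableD _ _ _ i1 i2; have i34 := cintegrableD _ _ _ i3 i4.
split; first exact: cintegrableD.
by rewrite !cexpectationD// e1 e2 e3 e4 add0r addr0.
Qed.

(** * Exact values of $\Psi_N$ on the words needed *)

Let sum_delta N (i : nat) : (i < N)%N -> \sum_(j < N) ((i == j)%:R : R[i]) = 1.
Proof.
move=> iN; rewrite (bigD1 (Ordinal iN))//= eqxx big1 ?addr0// => j.
by rewrite -val_eqE eq_sym /= => /negbTE->.
Qed.

Let sum_const N (c : R[i]) : \sum_(j < N) c = N%:R * c.
Proof. by rewrite sumr_const card_ord mulr_natl. Qed.

Lemma Psi_A n : Psi P (fun w => A_mx X n.+1 w) = 0.
Proof.
(* One factor $1/N$ comes from $A_N$ and the other from $C_N$. *)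
rewrite /Psi (_ : (fun w => _) = fun w => \sum_(i < n.+1) \sum_(j < n.+1)
  n.+1%:R^-1 ^+ 2 * Y i j w); last first.
  apply/funext => w; apply: eq_bigr => i _; rewrite mxE.
  by apply: eq_bigr => j _; rewrite !mxE /Y; ring.
have iY i j : cintegrable P (fun w => n.+1%:R^-1 ^+ 2 * Y i j w).
  exact/cintegrableZ/(expectation_entry i j).1.
rewrite cexpectation_sum => [|i]; last exact: cintegrable_sum.
rewrite big1// => i _; rewrite cexpectation_sum// big1// => j _.
have [iYij EY] := expectation_entry i j.
by rewrite (cexpectationZ _ _ _ iYij) EY mulr0.
Qed.

(** The trace is invariant under transposition and cyclic, and $C_N$ is symmetric, so this reduces
    to the value at $A_N$. *)
Lemma Psi_A_tr n : Psi P (fun w => (A_mx X n.+1 w)^T) = 0.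
Proof.
rewrite -(Psi_A n) /Psi; congr cexpectation; apply/funext => w.
rewrite -mxtrace_tr trmx_mul trmxK mxtrace_mulC; congr (\tr (_ *m _)).
by apply/matrixP => i j; rewrite !mxE.
Qed.

(** The covariance of $Y_{ij}$ and $Y_{kj}$ is $[i=j]+[k=j]$. Summed over $i,j,k$, each bracket
    gives $N^2$, against the scalar $N^{-3}$. *)
Lemma Psi_AAT n :
  Psi P (fun w => A_mx X n.+1 w * (A_mx X n.+1 w)^T) = 2 / n.+1%:R.
Proof.
rewrite /Psi (_ : (fun w => _) = fun w => \sum_(i < n.+1) \sum_(k < n.+1)
  \sum_(j < n.+1) n.+1%:R^-1 ^+ 3 * (Y i j w * Y k j w)); last first.
  apply/funext => w; apply: eq_bigr => i _; rewrite mxE.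
  apply: eq_bigr => k _; rewrite !mxE mulr_suml.
  by apply: eq_bigr => j _; rewrite !mxE /Y; ring.
have iY i k j : cintegrable P (fun w => n.+1%:R^-1 ^+ 3 * (Y i j w * Y k j w)).
  exact/cintegrableZ/(covariance_entry i j k j).1.
have iS i k : cintegrable P (fun w => \sum_(j < n.+1)
    n.+1%:R^-1 ^+ 3 * (Y i j w * Y k j w)) by exact: cintegrable_sum.
rewrite cexpectation_sum => [|i]; last exact: cintegrable_sum.
under eq_bigr => i _.
  rewrite cexpectation_sum//.
  under eq_bigr => k _.
    rewrite cexpectation_sum//.
    under eq_bigr => j _ do
      rewrite (cexpectationZ _ _ _ (covariance_entry i j k j).1)
        (covariance_entry i j k j).2.
    rewrite -mulr_sumr big_split/= !sum_delta//.
    over.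
  rewrite sum_const.
  over.
rewrite sum_const; field.
by [].
Qed.

(** Here the covariance is $[i=l]+[k=j]$ with four free indices: each bracket sums to $N^3$, against
    the scalar $N^{-4}$. *)
Lemma Psi_ACA n :
  Psi P (fun w => A_mx X n.+1 w * C_mx R n.+1 * A_mx X n.+1 w) = 2 / n.+1%:R.
Proof.
rewrite /Psi (_ : (fun w => _) = fun w => \sum_(i < n.+1) \sum_(l < n.+1)
  \sum_(k < n.+1) \sum_(j < n.+1)
  n.+1%:R^-1 ^+ 4 * (Y i j w * Y k l w)); last first.
  apply/funext => w; apply: eq_bigr => i _; rewrite mxE.
  apply: eq_bigr => l _; rewrite !mxE mulr_suml.
  apply: eq_bigr => k _; rewrite !mxE !mulr_suml.
  by apply: eq_bigr => j _; rewrite !mxE /Y; ring.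
have iY i j k l : cintegrable P (fun w => n.+1%:R^-1 ^+ 4 * (Y i j w * Y k l w)).
  exact/cintegrableZ/(covariance_entry i j k l).1.
have iS i l k : cintegrable P (fun w => \sum_(j < n.+1)
    n.+1%:R^-1 ^+ 4 * (Y i j w * Y k l w)) by exact: cintegrable_sum.
have iSS i l : cintegrable P (fun w => \sum_(k < n.+1) \sum_(j < n.+1)
    n.+1%:R^-1 ^+ 4 * (Y i j w * Y k l w)) by exact: cintegrable_sum.
rewrite cexpectation_sum => [|i]; last exact: cintegrable_sum.
under eq_bigr => i _.
  rewrite cexpectation_sum//.
  under eq_bigr => l _.
    rewrite cexpectation_sum//.
    under eq_bigr => k _.
      rewrite cexpectation_sum//.
      under eq_bigr => j _ do
        rewrite (cexpectationZ _ _ _ (covariance_entry i j k l).1)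
          (covariance_entry i j k l).2.
      rewrite -mulr_sumr big_split/= sum_const sum_delta//.
      over.
    rewrite sum_const.
    over.
  (* The bracket $[k=j]$ was used up by the sum over $j$; the bracket $[i=l]$ is used up only here,
     by the sum over $l$. *)
  rewrite -!mulr_sumr big_split/= -mulr_sumr sum_delta// sum_const.
  over.
rewrite sum_const; field.
by [].
Qed.

End StandardCGaussian.

(** * Words as test polynomials, and limits of constant sequences *)

Section NonCommutativeMonomials.
Context {K : comNzRingType}.

Definition ncmonomial (s : seq 'I_3) : ncpoly K := mkmalgU (FMonom s) 1.

Lemma nceval_monomial (A : algType K) (x y z : A) s :
  nceval x y z (ncmonomial s) = \prod_(i <- s) tnth [tuple x; y; z] i.
Proof. by rewrite /nceval mmapU /= scale1r mul1r. Qed.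

End NonCommutativeMonomials.

(** Uniqueness of limits in the complex plane. Constant sequences suffice, since $\Psi_N(A_N)=0$ and
    $N\cdot 2/N=2$ hold for every $N\ge1$. *)
Lemma cst_cvg_eq {R : realType} (u : nat -> R[i]) (k l : R[i]) :
  (forall n, u n = k) -> u n @[n --> \oo] --> (l : R[i]^o) -> l = k.
Proof.
move=> uk; rewrite (_ : u = fun=> k); last exact/funext.
move=> kl; apply: (@cvg_unique _ (@norm_hausdorff _ R[i]^o) _ _ _ _ kl).
exact: cvg_cst.
Qed.

Lemma nonunital_generated_gen {K : comNzRingType} {A : algType K} (u : A) :
  nonunital_generated u u.
Proof. by move=> S [_]; apply. Qed.

(** * Two words that contradict infinitesimal Boolean independence *)

Theorem theoremA1 (R : realType) (d : measure_display) (T : measurableType d)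
    (P : probability T R) (X : nat -> T -> R[i])
    (hX : iid_standard_cgaussian P X)
    (A : algType R[i]) (phi phi' : {scalar A}) (a abar c : A)
    (hcvg : cvg_inf_distribution P
              (fun N w => A_mx X N w)
              (fun N w => (A_mx X N w)^T)
              (fun N _ => C_mx R N)
              phi phi' a abar c) :
  ~ inf_boolean_independent phi phi' a abar /\
  ~ inf_boolean_independent phi phi' a c.
Proof.
(* The three letters, numbered as in the tuple of [nceval]: [a], [abar], [c]. *)
pose ia : 'I_3 := @Ordinal 3 0 isT.
pose ib : 'I_3 := @Ordinal 3 1 isT.
pose ic : 'I_3 := @Ordinal 3 2 isT.
have phi_a : phi a = 0.
  have [+ _] := hcvg (ncmonomial [:: ia]).
  rewrite nceval_monomial big_seq1; apply: cst_cvg_eq => n.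
  rewrite -(Psi_A P X hX n); congr Psi; apply/funext => w.
  by rewrite nceval_monomial big_seq1.
have phi_abar : phi abar = 0.
  have [+ _] := hcvg (ncmonomial [:: ib]).
  rewrite nceval_monomial big_seq1; apply: cst_cvg_eq => n.
  rewrite -(Psi_A_tr P X hX n); congr Psi; apply/funext => w.
  by rewrite nceval_monomial big_seq1.
(* With $\varphi=0$ at the word, the rescaled sequence is constantly 2. The vanishing of $\varphi$
   is supplied below by its multiplicativity under the assumed independence. *)
have phi'_2 s : phi (nceval a abar c (ncmonomial s)) = 0 ->
    (forall n, Psi P (fun w => nceval (A_mx X n.+1 w) (A_mx X n.+1 w)^T
      (C_mx R n.+1) (ncmonomial s)) = 2 / n.+1%:R) ->
    phi' (nceval a abar c (ncmonomial s)) = 2.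
  move=> phi0 psi2; have [_] := hcvg (ncmonomial s).
  apply: cst_cvg_eq => n; rewrite phi0 subr0 psi2 mulrC divfK//.
have phi'_aabar : phi (a * abar) = 0 -> phi' (a * abar) = 2.
  have := phi'_2 [:: ia; ib].
  rewrite nceval_monomial big_cons big_seq1 => + phi0; apply => // n.
  rewrite -(Psi_AAT P X hX n); congr Psi; apply/funext => w.
  by rewrite nceval_monomial big_cons big_seq1.
have phi'_aca : phi (a * c * a) = 0 -> phi' (a * c * a) = 2.
  have := phi'_2 [:: ia; ic; ia].
  rewrite nceval_monomial !big_cons big_nil mulr1 mulrA => + phi0; apply => // n.
  rewrite -(Psi_ACA P X hX n); congr Psi; apply/funext => w.
  by rewrite nceval_monomial !big_cons big_nil mulr1 mulrA.
have two_neq0 : (2 : R[i]) <> 0 by apply/eqP; rewrite pnatr_eq0.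
split=> indep.
  (* The word $a\bar a$. Each summand for $\varphi'$ keeps $\varphi$ at one of the two letters,
     hence is zero. *)
  have [|||] := indep 2 (fun j => j == 1) (fun j => if j == 1 then abar else a).
  - by [].
  - by case.
  - by case=> [|[|j]] //= _; exact: nonunital_generated_gen.
  rewrite /index_iota/= !big_cons !big_nil/= ?big_cons ?big_nil/=.
  rewrite phi_a phi_abar !mulr1 !mul1r !mul0r !mulr0 !addr0 => phi0 phi'0.
  by apply: two_neq0; rewrite -phi'_aabar.
(* The word $aca$. As $a$ occurs twice and $\varphi'$ acts at one position only, every summand
   contains $\varphi(a)=0$, whatever the value at $c$. *)
have [|||] := indep 3 (fun j => j == 1) (fun j => if j == 1 then c else a).
- by [].
- by case=> [|[|j]].
- by case=> [|[|[|j]]] //= _; exact: nonunital_generated_gen.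
rewrite /index_iota/= !big_cons !big_nil/= ?big_cons ?big_nil/=.
rewrite phi_a !mulr1 !mul1r !mul0r !mulr0 !addr0 mulrA => phi0 phi'0.
by apply: two_neq0; rewrite -phi'_aca.
Qed.
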